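(* Consider the closed-loop system formed by the power network dynamics, the generation and controllable demand dynamics, and the Extended Primal-Dual scheme, as specified in the context, with state $(\eta,\psi,\omega,x,p^c)$. Then the solutions of this system globally asymptotically converge to the set of its equilibria (that is, for every initial condition the solution converges to the set of equilibria as $t\to\infty$), where $\omega^*=\boldsymbol{0}_{|\mathcal N|}$ (every equilibrium has all frequency deviations equal to zero).
   Context: Network. $(\mathcal N,\mathcal E)$ is a finite connected graph (buses and lines), with an arbitrary orientation of its edges, so that $(i,j)\in\mathcal E$ implies $(j,i)\notin\mathcal E$. For $j\in\mathcal N$, $\mathcal N^p_j=\{k:(k,j)\in\mathcal E\}$ and $\mathcal N^s_j=\{k:(j,k)\in\mathcal E\}$. At each bus $j$ there is a finite set $\mathcal N^G_j$ of generation units and a finite set $\mathcal N^L_j$ of controllable loads (disjoint), and $\mathcal N_j=\mathcal N^G_j\cup\mathcal N^L_j$ is the set of active units at bus $j$. Units are indexed by pairs $(k,j)$ with $k\in\mathcal N_j$, $j\in\mathcal N$; $\widetilde{\mathcal N}$ is the set of all active units in the network (the union over $j$ of the $\mathcal N_j$). Power network dynamics (real-valued, continuous time): $\dot\eta_{ij}=\omega_i-\omega_j$, $(i,j)\in\mathcal E$; $M_j\dot\omega_j=\sum_{k\in\mathcal N^G_j}p^M_{k,j}-\sum_{k\in\mathcal N^L_j}d^c_{k,j}-\sum_{k\in\mathcal N_j}p^L_{k,j}-D_j\omega_j-\sum_{i\in\mathcal N^s_j}p_{ji}+\sum_{i\in\mathcal N^p_j}p_{ij}$, $j\in\mathcal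 N$; $p_{ij}=B_{ij}\eta_{ij}$, $(i,j)\in\mathcal E$; with constants $B_{ij}>0$, $M_j>0$, $D_j>0$, and constant uncontrollable demands $p^L_{k,j}\in\mathbb R$. Generation and controllable demand dynamics: $\tau_{k,j}\dot x_{k,j}=-x_{k,j}+m_{k,j}(u_{k,j}-\omega_j)$ and $p^M_{k,j}=x_{k,j}+h_{k,j}(u_{k,j}-\omega_j)$ for $k\in\mathcal N^G_j$, $j\in\mathcal N$; $d^c_{k,j}=-h_{k,j}(u_{k,j}-\omega_j)$ for $k\in\mathcal N^L_j$, $j\in\mathcal N$; with constants $\tau_{k,j},m_{k,j},h_{k,j}>0$. Prosumption vector: $\widetilde s\in\mathbb R^{|\widetilde{\mathcal N}|}$ has entries $\widetilde s_{k,j}=-p^M_{k,j}+p^L_{k,j}$ for $k\in\mathcal N^G_j$ and $\widetilde s_{k,j}=d^c_{k,j}+p^L_{k,j}$ for $k\in\mathcal N^L_j$. Extended Primal-Dual scheme. $(\widetilde{\mathcal N},\widetilde{\mathcal E})$ is a connected (communication) graph with incidence matrix $H\in\mathbb R^{|\widetilde{\mathcal N}|\times|\widetilde{\mathcal E}|}$, where $H_{ie}=+1$ if $i$ is the positive end of edge $e$, $-1$ if $i$ is the negative end of $e$, and $0$ otherwise. The scheme is $\widetilde\Gamma\dot\psi=H^Tp^c$, $\quad\Gamma\dot p^c=\widetilde s-H\psi$, $\quad u=p^c$, where $\psi\in\mathbb R^{|\widetilde{\mathcal E}|}$, $p^c=[p^c_{k,j}]\in\mathbb R^{|\widetilde{\mathcal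 N}|}$, $u=[u_{k,j}]$, and $\widetilde\Gamma,\Gamma$ are diagonal matrices with positive diagonal entries. An equilibrium is a point $(\eta^*,\psi^*,\omega^*,x^*,p^{c,*})$ at which all time derivatives of the closed-loop system are zero. *)

(* Defs.v *)
From HB Require Import structures.
From mathcomp Require Import all_boot all_order all_algebra.
From mathcomp Require Import all_classical all_reals all_analysis.

Set Implicit Arguments.
Unset Strict Implicit.
Unset Printing Implicit Defensive.

Import Order.TTheory GRing.Theory Num.Theory.
Import numFieldNormedType.Exports.

Local Open Scope classical_set_scope.
Local Open Scope ring_scope.

(* A graph with an arbitrary orientation is given by the relation "(a, b) is an
   edge directed from a to b"; [oriented] also excludes self-loops. *)
Definition oriented (T : finType) (E : rel T) : Prop :=
  forall a b, E a b -> ~~ E b a.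

(* Connectedness of the underlying undirected graph. *)
Definition connected_graph (T : finType) (E : rel T) : Prop :=
  forall a b, connect [rel c d | E c d || E d c] a b.

Definition edge (T : finType) (E : rel T) : finType :=
  {e : T * T | E e.1 e.2}.

Definition edge_src (T : finType) (E : rel T) (e : edge E) : T := (val e).1.
Definition edge_tgt (T : finType) (E : rel T) (e : edge E) : T := (val e).2.

(* The positive end of an edge is its source, the negative end its target. *)
Definition incidence (R : realType) (T : finType) (E : rel T)
    (i : T) (e : edge E) : R :=
  if i == edge_src e then 1 else if i == edge_tgt e then -1 else 0.

(* The generation units (resp. controllable loads) at bus j form the finite type
   gen j (resp. load j).  The active units at j are their disjoint union, and the
   active units of the network are the pairs of a bus j and an active unit at j. *)
Definition units (bus : finType) (gen load : bus -> finType) : finType :=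
  {j : bus & (gen j + load j)%type}.

Record system (R : realType) := System {
  bus : finType;
  line : rel bus;
  gen : bus -> finType;
  load : bus -> finType;
  comm : rel (units gen load);
  line_B : edge line -> R;
  bus_M : bus -> R;
  bus_D : bus -> R;
  gen_tau : forall j, gen j -> R;
  gen_m : forall j, gen j -> R;
  unit_h : units gen load -> R;
  unit_pL : units gen load -> R;
  comm_Gamma : edge comm -> R;   (* diagonal of the matrix multiplying psi' *)
  unit_Gamma : units gen load -> R   (* diagonal of the matrix multiplying pc' *)
}.

Definition unit_of (R : realType) (S : system R) : finType :=
  units (@gen R S) (@load R S).

Definition ugen (R : realType) (S : system R) (j : bus S) (k : gen j) :
  unit_of S := Tagged (fun j => (gen j + load j)%type) (inl k).
Definition uload (R : realType) (S : system R) (j : bus S) (k : load j) :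
  unit_of S := Tagged (fun j => (gen j + load j)%type) (inr k).
Definition uactive (R : realType) (S : system R) (j : bus S)
    (k : (gen j + load j)%type) : unit_of S :=
  Tagged (fun j => (gen j + load j)%type) k.

Record state (R : realType) (S : system R) := State {
  eta : edge (@line R S) -> R;
  psi : edge (@comm R S) -> R;
  omega : bus S -> R;
  xgen : forall j : bus S, gen j -> R;
  pc : unit_of S -> R
}.

Definition state0 (R : realType) (S : system R) : state S :=
  State (fun=> 0) (fun=> 0) (fun=> 0) (fun _ _ => 0) (fun=> 0).

Definition coord_index (R : realType) (S : system R) : finType :=
  (edge (@line R S) + edge (@comm R S) + bus S +
   {j : bus S & gen j} + unit_of S)%type.

Definition coord (R : realType) (S : system R) (c : coord_index S)
    (z : state S) : R :=
  match c with
  | inl (inl (inl (inl e))) => eta z e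
  | inl (inl (inl (inr e))) => psi z e
  | inl (inl (inr j)) => omega z j
  | inl (inr k) => xgen z (tagged k)
  | inr i => pc z i
  end.

Section Dynamics.
Context (R : realType) (S : system R).
Implicit Types (z dz : state S) (j : bus S).

Definition flow z (e : edge (@line R S)) : R := line_B e * eta z e.

(* The input u generated by the primal-dual scheme. *)
Definition input z (i : unit_of S) : R := pc z i.

Definition pM z j (k : gen j) : R :=
  xgen z k + unit_h (ugen k) * (input z (ugen k) - omega z j).

Definition dc z j (k : load j) : R :=
  - (unit_h (uload k) * (input z (uload k) - omega z j)).

Definition prosumption z (i : unit_of S) : R :=
  match i with
  | existT j (inl k) => - pM z k + unit_pL (ugen k)
  | existT j (inr k) => dc z k + unit_pL (uload k)
  end.

(* [dynamics z dz]: the closed-loop equations hold at the state z when the time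
   derivatives of its components are those of dz. *)
Definition dynamics z dz : Prop :=
  [/\ forall e : edge (@line R S),
        eta dz e = omega z (edge_src e) - omega z (edge_tgt e),
      forall j, bus_M j * omega dz j =
        \sum_(k : gen j) pM z k - \sum_(k : load j) dc z k
        - \sum_(k : (gen j + load j)%type) unit_pL (uactive k)
        - bus_D j * omega z j
        - \sum_(e : edge (@line R S) | edge_src e == j) flow z e
        + \sum_(e : edge (@line R S) | edge_tgt e == j) flow z e,
      forall j (k : gen j), gen_tau k * xgen dz k =
        - xgen z k + gen_m k * (input z (ugen k) - omega z j),
      forall e : edge (@comm R S), comm_Gamma e * psi dz e =
        \sum_(i : unit_of S) incidence R i e * pc z i
    & forall i : unit_of S, unit_Gamma i * pc dz i =
        prosumption z i
        - \sum_(e : edge (@comm R S)) incidence R i e * psi z e].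

Definition equilibrium z : Prop := dynamics z (state0 S).

(* Classical solutions on [0, +oo[: continuous on [0, +oo[ and differentiable
   with the closed-loop equations on ]0, +oo[ (the equations then hold at 0 with
   the right derivative); values at negative times are irrelevant. *)
Definition is_solution (z : R -> state S) : Prop :=
  (forall c : coord_index S,
     {within `[0, +oo[, continuous (fun t => coord c (z t))}) /\
  (forall t : R, 0 < t -> exists dz : state S,
     (forall c : coord_index S,
        is_derive t 1 (fun s => coord c (z s)) (coord c dz)) /\
     dynamics (z t) dz).

(* The distance to the set A tends to 0, for the maximum norm on the
   finite-dimensional state space. *)
Definition converges_to_set (A : state S -> Prop) (z : R -> state S) : Prop :=
  forall eps : R, 0 < eps -> \forall t \near +oo,
    exists2 a : state S, A a &
      forall c : coord_index S, `|coord c (z t) - coord c a| < eps.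

End Dynamics.

(* Main.v *)
Require Import Defs.
From mathcomp Require Import all_boot all_order all_algebra.
From mathcomp Require Import all_classical all_reals all_analysis.
From mathcomp Require Import ring lra.

Import Order.TTheory GRing.Theory Num.Theory.
Import numFieldNormedType.Exports.

Local Open Scope ring_scope.

(* Subtracting an equilibrium, the quadratic energy
     V = sum B eta^2 + sum Gamma~ psi^2 + sum M omega^2 + sum (tau/m) x^2 + sum Gamma (p^c)^2
   satisfies V' = -2 W with W = sum D omega^2 + sum h (p^c - omega)^2 + sum x^2/m.  Hence all
   deviations are bounded, and Barbalat's lemma gives W -> 0, so omega, p^c, x -> 0.  Barbalat
   again, applied to omega and p^c themselves, gives omega', p^c' -> 0, i.e. the divergences of
   the line flows and of psi converge to their equilibrium values.  On a connected graph the
   divergence has a linear right inverse on supplies of total sum 0; it provides an equilibrium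
   and also the vanishing correction of (eta, psi) that turns the state z(t) into one. *)

(** * Incidence matrices and divergences on oriented graphs *)

Lemma edge_tgt_neq_src {T : finType} {E : rel T} (oE : oriented E) (e : edge E) :
  edge_tgt e != edge_src e.
Proof.
apply/eqP => tE; have He := valP e; have := oE _ _ He.
by rewrite /edge_tgt /edge_src in tE; rewrite tE in He *; rewrite He.
Qed.

Lemma incidence_transpose {R : realType} {T : finType} {E : rel T}
    (oE : oriented E) (w : T -> R) (e : edge E) :
  \sum_i incidence R i e * w i = w (edge_src e) - w (edge_tgt e).
Proof.
have neq := edge_tgt_neq_src oE e.
rewrite (bigD1 (edge_src e)) //= (bigD1 (edge_tgt e)) //= big1 => [|i].
  by rewrite /incidence !eqxx (negPf neq) mul1r mulN1r addr0.
by case/andP => /negPf is_ /negPf it; rewrite /incidence is_ it mul0r.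
Qed.

Lemma sum_incidence {R : realType} {T : finType} {E : rel T}
    (oE : oriented E) (e : edge E) :
  \sum_i incidence R i e = 0 :> R.
Proof.
transitivity (\sum_i incidence R i e * 1).
  by apply: eq_bigr => i _; rewrite mulr1.
by rewrite incidence_transpose // subrr.
Qed.

Definition divergence {R : realType} {T : finType} {E : rel T}
    (f : edge E -> R) (i : T) : R := \sum_e incidence R i e * f e.

Lemma sum_divergence {R : realType} {T : finType} {E : rel T}
    (oE : oriented E) (f : edge E -> R) :
  \sum_i divergence f i = 0.
Proof.
rewrite exchange_big /= big1 // => e _.
by rewrite -mulr_suml sum_incidence // mul0r.
Qed.

Lemma divergenceE {R : realType} {T : finType} {E : rel T}
    (oE : oriented E) (f : edge E -> R) (i : T) :
  divergence f i = \sum_(e | edge_src e == i) f e - \sum_(e | edge_tgt e == i) f e.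
Proof.
rewrite /divergence [in RHS]big_mkcond [X in _ - X]big_mkcond /= -sumrB.
apply: eq_bigr => e _; rewrite /incidence !(eq_sym i).
have neq := edge_tgt_neq_src oE e.
case: eqVneq => [<-|_]; first by rewrite (negPf neq) mul1r subr0.
by case: ifP => _; rewrite ?mulN1r ?mul0r sub0r ?subr0 // oppr0.
Qed.

Lemma divergenceB {R : realType} {T : finType} {E : rel T}
    (f g : edge E -> R) (i : T) :
  divergence (fun e => f e - g e) i = divergence f i - divergence g i.
Proof. by rewrite /divergence -sumrB; apply: eq_bigr => e _; rewrite mulrBr. Qed.

Lemma divergence_delta {R : realType} {T : finType} {E : rel T}
    (oE : oriented E) (e0 : edge E) (i : T) :
  divergence (fun e => (e == e0)%:R) i =
  (i == edge_src e0)%:R - (i == edge_tgt e0)%:R :> R.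
Proof.
rewrite -(incidence_transpose oE (fun k => (i == k)%:R)) /divergence.
rewrite (bigD1 e0) //= eqxx mulr1 big1 => [|e /negPf->]; last by rewrite mulr0.
rewrite (bigD1 i) //= eqxx mulr1 [X in _ = _ + X]big1 // => k.
by rewrite eq_sym => /negPf->; rewrite mulr0.
Qed.

(** A unit flow is pushed along the path, by induction on its length. A path edge traversed against
    its orientation carries -1 instead of 1. *)
Lemma connect_divergence {R : realType} {T : finType} {E : rel T}
    (oE : oriented E) (a b : T) :
  connect [rel c d | E c d || E d c] a b ->
  exists f : edge E -> R,
    forall i, divergence f i = (i == a)%:R - (i == b)%:R.
Proof.
case/connectP => p; elim: p a => [|c p IH] a /=.
  move=> _ ->; exists (fun=> 0) => i.
  by rewrite subrr /divergence big1 // => e _; rewrite mulr0.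
case/andP => Eac pc bE; have [f fE] := IH _ pc bE.
have [g gE] : exists g : edge E -> R,
    forall i, divergence g i = (i == c)%:R - (i == a)%:R.
  case/orP: Eac => Eac.
  - pose e0 : edge E := exist _ (a, c) Eac.
    (* The indicator of [e0] has divergence +1 at [a] and -1 at [c], so it is negated; the form
       [0 - _] lets [divergenceB] apply. *)
    exists (fun e => 0 - (e == e0)%:R) => i.
    rewrite divergenceB divergence_delta // [X in X - _]/divergence big1 ?sub0r ?opprB//.
    by move=> e _; rewrite mulr0.
  - pose e0 : edge E := exist _ (c, a) Eac.
    by exists (fun e => (e == e0)%:R) => i; rewrite divergence_delta.
exists (fun e => f e - g e) => i; rewrite divergenceB fE gE.
by ring.
Qed.

(* [G k] carries one unit along a path between [k] and a fixed root. *)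
Lemma divergence_right_inverse {R : realType} {T : finType} {E : rel T}
    (oE : oriented E) (cE : connected_graph E) :
  exists G : T -> edge E -> R, forall b : T -> R, \sum_i b i = 0 ->
    forall i, divergence (fun e => \sum_k b k * G k e) i = b i.
Proof.
(* Without vertices there is no root to choose, and the claim is vacuous. *)
have [/card0_eq T0|/card_gt0P[r _]] := posnP #|T|.
  by exists (fun _ _ => 0) => b _ i; have := T0 i; rewrite !inE.
have [G GE] := @boolp.choice _ _ (fun k (f : edge E -> R) =>
  forall i, divergence f i = (i == k)%:R - (i == r)%:R)
  (fun k => connect_divergence oE _ _ (cE k r)).
exists G => b sb0 i; rewrite /divergence.
(* By linearity the divergence is [b] minus the total of [b] placed at the root [r], and that total
   is 0. *)
transitivity (\sum_k b k * divergence (G k) i).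
  under eq_bigr do rewrite mulr_sumr.
  rewrite exchange_big /=; apply: eq_bigr => k _; rewrite /divergence mulr_sumr.
  by apply: eq_bigr => e _; rewrite mulrCA.
under eq_bigr do rewrite GE mulrBr.
rewrite sumrB -mulr_suml sb0 mul0r subr0 (bigD1 i) //= eqxx mulr1 big1 ?addr0 //.
by move=> k; rewrite eq_sym => /negPf->; rewrite mulr0.
Qed.

(** * Barbalat's lemma and calculus on the positive half-line *)

Lemma MVT_gt0 {R : realType} {f df : R -> R} {a b : R} : 0 < a -> a < b ->
  (forall t : R, 0 < t -> is_derive t 1 f (df t)) ->
  exists2 c, a < c < b & f b - f a = df c * (b - a).
Proof.
move=> a0 ab fd; have [| |c] := @MVT R f df a b ab.
- by move=> x; rewrite in_itv /= => /andP[ax _]; apply: fd; exact: lt_trans ax.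
- apply: derivable_within_continuous => x; rewrite in_itv /= => /andP[ax _].
  by have [] := fd x (lt_le_trans a0 ax).
by rewrite in_itv /=; exists c.
Qed.

(** On a window of length [d], the mean value theorem gives a point [c] where [g c] is the slope of
    [f], which is small because [f] converges. The bound on [h] then keeps [g t] within [K * d] of
    [g c]. *)
Lemma barbalat {R : realType} {f g h : R -> R} {l K : R} :
  (f t @[t --> +oo] --> l)%classic ->
  (forall t : R, 0 < t -> is_derive t 1 f (g t)) ->
  (forall t : R, 0 < t -> is_derive t 1 g (h t)) ->
  (forall t : R, 1 <= t -> `|h t| <= K) ->
  (g t @[t --> +oo] --> (0 : R))%classic.
Proof.
move=> fl fg gh hK; apply/cvgr0Pnorm_lt => e e0.
have K0 : 0 <= K by apply: le_trans (hK 1 _).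
(* This gives [K * d < e / 2]; using [K + 1] keeps the quotient meaningful when [K = 0]. *)
pose d := e / (2 * (K + 1)).
have d0 : 0 < d by rewrite divr_gt0 // mulr_gt0 // ltr_wpDl.
have Kd : K * d < e / 2.
  have -> : e / 2 = (K + 1) * d by rewrite /d; field; rewrite gt_eqF // ltr_wpDl.
  by rewrite ltr_pM2r // ltrDl.
have ed : 0 < d * e / 4 by rewrite divr_gt0 // mulr_gt0.
(* With [f] within [d * e / 4] of [l] at both ends of the window, its increment is below
   [d * e / 2], so its slope is below [e / 2]. *)
have := (@cvgrPdist_lt _ R _ _ _ f l).1 fl _ ed.
case=> M [_ HM]; exists (Num.max M 1); split; first exact: num_real.
move=> t; rewrite gt_max => /andP[Mt t1].
have t0 : 0 < t by apply: lt_trans t1.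
have ft := HM t Mt; have ftd := HM (t + d) (lt_trans Mt (ltr_pwDr d0 (lexx t))).
rewrite /= in ft ftd.
have tdt : t < t + d by rewrite ltrDl.
have [c /andP[tc ctd] fE] := MVT_gt0 t0 tdt fg.
have gc : `|g c - g t| <= K * (c - t).
  have [s /andP[ts _] ->] := MVT_gt0 t0 tc gh.
  rewrite normrM (gtr0_norm (_ : 0 < c - t)) ?subr_gt0 //.
  by rewrite ler_wpM2r ?subr_ge0 ?(ltW tc) // hK // (le_trans (ltW t1)) // ltW.
have gc' : `|g c - g t| < e / 2.
  apply: le_lt_trans gc (le_lt_trans _ Kd); rewrite ler_wpM2l //.
  by rewrite lerBlDl ltW.
have gcs : `|g c| < e / 2.
  rewrite -(ltr_pM2r d0) -[X in _ * X](gtr0_norm d0) -normrM.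
  have <- : f (t + d) - f t = g c * d by rewrite fE; ring.
  have -> : f (t + d) - f t = (l - f t) - (l - f (t + d)) by ring.
  apply: le_lt_trans (ler_normB _ _) _.
  have {gc gc'} -> : e / 2 * d = d * e / 4 + d * e / 4 by field.
  lra.
have -> : g t = g c - (g c - g t) by ring.
apply: le_lt_trans (ler_normB _ _) _.
lra.
Qed.

(** The limit is the infimum of the values on the open half-line, since [f] is nonincreasing and
    bounded below there. *)
Lemma cvg_of_nonpos_derive {R : realType} {f g : R -> R} :
  (forall t : R, 0 < t -> is_derive t 1 f (g t)) ->
  (forall t : R, 0 < t -> g t <= 0) -> (forall t : R, 0 < t -> 0 <= f t) ->
  (forall s t : R, 0 < s -> s <= t -> f t <= f s) /\
  exists l : R, (f t @[t --> +oo] --> l)%classic.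
Proof.
move=> fg g0 f0.
have dec s t : 0 < s -> s <= t -> f t <= f s.
  move=> s0; rewrite le_eqVlt => /orP[/eqP->//|st].
  have [c /andP[sc ct] fE] := MVT_gt0 s0 st fg.
  rewrite -subr_le0 fE mulr_le0_ge0 //; last by rewrite subr_ge0 ltW.
  by apply: g0; exact: lt_trans sc.
split=> //.
pose A := [set f t | t in [set t | 0 < t]]%classic.
have A_inf : has_inf A.
  split; first by exists (f 1), 1 => //=; exact: ltr01.
  by exists 0 => _ [t t0 <-]; exact: f0.
exists (inf A); apply/cvgrPdist_lt => e e0.
have [_ [s s0 <-] sA] := inf_adherent e0 A_inf.
exists s; split; first exact: num_real.
move=> t st /=; rewrite distrC ger0_norm.
  by rewrite ltrBlDl; apply: le_lt_trans (dec _ _ _ (ltW st)) sA.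
rewrite subr_ge0; apply: ge_inf; first exact: A_inf.2.
by exists t => //; exact: lt_trans st.
Qed.

Lemma is_derive_sumf {R : realType} {I : finType} {F G : I -> R -> R} {P : pred I}
    {t : R} :
  (forall i, is_derive t 1 (F i) (G i t)) ->
  is_derive t 1 (fun s => \sum_(i | P i) F i s) (\sum_(i | P i) G i t).
Proof.
move=> FG; rewrite -big_filter.
under [X in is_derive _ _ X _]funext do rewrite -big_filter.
elim: (seq.filter _ _) => [|i r IH].
  rewrite big_nil; under [X in is_derive _ _ X _]funext do rewrite big_nil.
  exact: is_derive_cst.
rewrite big_cons; under [X in is_derive _ _ X _]funext do rewrite big_cons.
exact: is_deriveD.
Qed.

(** * Functions bounded together with their derivative *)

Definition bounded1y {R : realType} (f : R -> R) : Prop :=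
  exists K, forall t : R, 1 <= t -> `|f t| <= K.

Lemma bounded1yD {R : realType} (f g : R -> R) :
  bounded1y f -> bounded1y g -> bounded1y (fun t => f t + g t).
Proof.
move=> [K fK] [L gL]; exists (K + L) => t t1.
by apply: le_trans (ler_normD _ _) _; rewrite lerD ?fK ?gL.
Qed.

Lemma bounded1yN {R : realType} (f : R -> R) :
  bounded1y f -> bounded1y (fun t => - f t).
Proof. by move=> [K fK]; exists K => t t1; rewrite normrN fK. Qed.

Lemma bounded1yM {R : realType} (f g : R -> R) :
  bounded1y f -> bounded1y g -> bounded1y (fun t => f t * g t).
Proof.
by move=> [K fK] [L gL]; exists (K * L) => t t1; rewrite normrM ler_pM ?fK ?gL.
Qed.

Lemma bounded1yZ {R : realType} (c : R) (f : R -> R) :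
  bounded1y f -> bounded1y (fun t => c * f t).
Proof. by apply: bounded1yM; exists `|c|. Qed.

Lemma bounded1y_sum {R : realType} {I : finType} {P : pred I} {F : I -> R -> R} :
  (forall i, bounded1y (F i)) -> bounded1y (fun t => \sum_(i | P i) F i t).
Proof.
move=> /boolp.choice[K FK]; exists (\sum_(i | P i) K i) => t t1.
by apply: le_trans (ler_norm_sum _ _ _) _; apply: ler_sum => i _; exact: FK.
Qed.

(* Boundedness is only asked on [1, +oo[, so that the behaviour near 0 plays no role. *)
Definition C1b {R : realType} (f : R -> R) : Prop :=
  exists g : R -> R, [/\ forall t : R, 0 < t -> is_derive t 1 f (g t),
    bounded1y f & bounded1y g].

Lemma C1bD {R : realType} (f g : R -> R) :
  C1b f -> C1b g -> C1b (fun t => f t + g t).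
Proof.
move=> [f' [df bf bf']] [g' [dg bg bg']].
exists (fun t => f' t + g' t); split; try exact: bounded1yD.
by move=> t t0; apply: is_deriveD; [exact: df|exact: dg].
Qed.

Lemma C1bM {R : realType} (f g : R -> R) :
  C1b f -> C1b g -> C1b (fun t => f t * g t).
Proof.
move=> [f' [df bf bf']] [g' [dg bg bg']].
exists (fun t => f t * g' t + g t * f' t); split; first 1 last.
- exact: bounded1yM.
- by apply: bounded1yD; exact: bounded1yM.
by move=> t t0; apply: is_deriveM; [exact: df|exact: dg].
Qed.

Lemma C1bZ {R : realType} (c : R) (f : R -> R) : C1b f -> C1b (fun t => c * f t).
Proof.
apply: C1bM; exists (fun=> 0); split; first by move=> t _; exact: is_derive_cst.
- by exists `|c|.
- by exists 0 => t _; rewrite normr0.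
Qed.

Lemma C1bN {R : realType} (f : R -> R) : C1b f -> C1b (fun t => - f t).
Proof.
move=> /(C1bZ (-1)).
by under [X in C1b X]funext do rewrite mulN1r.
Qed.

Lemma C1b_sum {R : realType} {I : finType} {P : pred I} {F : I -> R -> R} :
  (forall i, C1b (F i)) -> C1b (fun t => \sum_(i | P i) F i t).
Proof.
move=> /boolp.choice[G FG].
exists (fun t => \sum_(i | P i) G i t); split.
- by move=> t t0; apply: is_derive_sumf => i; have [dF _ _] := FG i; exact: dF.
- by apply: bounded1y_sum => i; have [] := FG i.
- by apply: bounded1y_sum => i; have [] := FG i.
Qed.

Lemma barbalat_C1b {R : realType} {f g : R -> R} {l : R} :
  (f t @[t --> +oo] --> l)%classic ->
  (forall t : R, 0 < t -> is_derive t 1 f (g t)) -> C1b g ->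
  (g t @[t --> +oo] --> (0 : R))%classic.
Proof. by move=> fl fg [h [gh _ [K hK]]]; exact: (barbalat fl fg gh hK). Qed.

(** * Functions tending to 0 at infinity *)

Lemma cvg0_sum {R : realType} {I : finType} {P : pred I} {F : I -> R -> R} :
  (forall i, F i t @[t --> +oo] --> (0 : R))%classic ->
  ((\sum_(i | P i) F i t) @[t --> +oo] --> (0 : R))%classic.
Proof.
move=> F0; have F0s (r : seq I) :
    ((\sum_(i <- r) F i t) @[t --> +oo] --> (0 : R))%classic.
  elim: r => [|i r IH].
    rewrite (_ : (fun t => _) = cst (0 : R)); first exact: cvg_cst.
    by apply/funext => t; rewrite big_nil.
  rewrite (_ : (fun t => _) = (F i \+ fun t => \sum_(k <- r) F k t)).
    have H := cvgD (F0 i) IH; rewrite addr0 in H; exact: H.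
  by apply/funext => t; rewrite big_cons.
rewrite (_ : (fun t => _) = fun t => \sum_(i <- seq.filter P (index_enum I)) F i t).
  exact: F0s.
by apply/funext => t; rewrite big_filter.
Qed.

Lemma cvg0_sq_le {R : realType} {f W : R -> R} {c : R} : 0 < c ->
  (W t @[t --> +oo] --> (0 : R))%classic ->
  (forall t : R, 0 < t -> c * f t ^+ 2 <= W t) ->
  (f t @[t --> +oo] --> (0 : R))%classic.
Proof.
move=> c0 W0 fW; apply/cvgr0Pnorm_lt => e e0.
have ce : 0 < c * e ^+ 2 by rewrite mulr_gt0 // exprn_gt0.
have [M [_ HM]] := (@cvgr0Pnorm_lt _ R _ _ _ W).1 W0 _ ce.
exists (Num.max M 0); split; first exact: num_real.
move=> t; rewrite gt_max => /andP[Mt t0].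
have := le_lt_trans (fW t t0) (le_lt_trans (ler_norm _) (HM t Mt)).
by rewrite ltr_pM2l // -real_normK ?num_real // ltr_pXn2r ?nnegrE ?normr_ge0 ?ltW.
Qed.

Lemma eq_cvg0 {R : realType} {f g : R -> R} : f =1 g ->
  (f t @[t --> +oo] --> (0 : R))%classic ->
  (g t @[t --> +oo] --> (0 : R))%classic.
Proof. by move=> /funext->. Qed.

Lemma cvg0Z {R : realType} (c : R) {f : R -> R} :
  (f t @[t --> +oo] --> (0 : R))%classic ->
  ((c * f t) @[t --> +oo] --> (0 : R))%classic.
Proof. by move=> f0; have H := cvgM (cvg_cst c) f0; rewrite mulr0 in H; exact: H. Qed.

Lemma cvg0B {R : realType} {f g : R -> R} :
  (f t @[t --> +oo] --> (0 : R))%classic ->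
  (g t @[t --> +oo] --> (0 : R))%classic ->
  ((f t - g t) @[t --> +oo] --> (0 : R))%classic.
Proof. by move=> f0 g0; have H := cvgB f0 g0; rewrite subr0 in H; exact: H. Qed.

(** * Energy argument for the deviations from an equilibrium *)

Section ReducedDynamics.
Context {R : realType} {bus unit line comm : finType}.
Context (at_bus : unit -> bus) (A : bus -> line -> R) (H : unit -> comm -> R).
Context (B : line -> R) (M D : bus -> R) (tau m h g Gu : unit -> R) (Gc : comm -> R).
Context (eta : line -> R -> R) (psi : comm -> R -> R) (om : bus -> R -> R)
  (x p : unit -> R -> R).
Hypotheses (B_gt0 : forall e, 0 < B e) (M_gt0 : forall j, 0 < M j)
  (D_gt0 : forall j, 0 < D j) (tau_gt0 : forall i, 0 < tau i)
  (m_gt0 : forall i, 0 < m i) (h_gt0 : forall i, 0 < h i)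
  (Gu_gt0 : forall i, 0 < Gu i) (Gc_gt0 : forall e, 0 < Gc e).

Let v i t := p i t - om (at_bus i) t.
(** The deviation of the prosumption of unit [i]. The uncontrollable demand has cancelled, so the
    reduced system is linear and homogeneous. *)
Let s i t := - x i t - h i * v i t.
Let net j t := \sum_e A j e * (B e * eta e t).
Let Hpsi i t := \sum_e H i e * psi e t.
Let deta e t := \sum_j A j e * om j t.
Let dom j t :=
  (M j)^-1 * (- (\sum_(i | at_bus i == j) s i t) - D j * om j t - net j t).
Let dx i t := (tau i)^-1 * (g i * (- x i t + m i * v i t)).
Let dp i t := (Gu i)^-1 * (s i t - Hpsi i t).
Let dpsi e t := (Gc e)^-1 * \sum_i H i e * p i t.

Hypotheses (eta_ode : forall e (t : R), 0 < t -> is_derive t 1 (eta e) (deta e t))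
  (om_ode : forall j (t : R), 0 < t -> is_derive t 1 (om j) (dom j t))
  (x_ode : forall i (t : R), 0 < t -> is_derive t 1 (x i) (dx i t))
  (p_ode : forall i (t : R), 0 < t -> is_derive t 1 (p i) (dp i t))
  (psi_ode : forall e (t : R), 0 < t -> is_derive t 1 (psi e) (dpsi e t))
  (* [g i] is 1 at a generator and 0 at a load, which has no state [x i]. *)
  (x_gen : forall i (t : R), 0 < t -> g i * x i t = x i t).

Let V t := \sum_e B e * eta e t ^+ 2 + \sum_j M j * om j t ^+ 2 +
  \sum_i tau i / m i * x i t ^+ 2 + \sum_i Gu i * p i t ^+ 2 +
  \sum_e Gc e * psi e t ^+ 2.
Let W t := \sum_j D j * om j t ^+ 2 + \sum_i h i * v i t ^+ 2 +
  \sum_i (m i)^-1 * x i t ^+ 2.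

(** The exchanges between [eta] and [om], and between [psi] and [p], go through a matrix and its
    transpose and cancel. What remains of the [om] and [p] terms is [v * s] per unit and the damping
    [D]. The weight [tau / m] makes the [x] term produce [x * v], which cancels the cross term of
    [v * s]. *)
Lemma is_derive_energy (t : R) : 0 < t -> is_derive t 1 V (- 2 * W t).
Proof.
move=> t0.
(* The grouping [c * df] matches the left-hand sides of the equations, so that the inverses in
   [dom], [dp] and [dpsi] simplify away. *)
have sq (c : R) (f : R -> R) (df : R) : is_derive t 1 f df ->
    is_derive t 1 (fun u => c * f u ^+ 2) (2 * (f t * (c * df))).
  move=> fd; have H0 := is_deriveM (is_derive_cst c t 1) (is_deriveM fd fd).
  apply: (is_derive_eq H0).
  by rewrite /GRing.scale /=; ring.
have VD : is_derive t 1 V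
   (\sum_e 2 * (eta e t * (B e * deta e t)) +
    \sum_j 2 * (om j t * (M j * dom j t)) +
    \sum_i 2 * (x i t * (tau i / m i * dx i t)) +
    \sum_i 2 * (p i t * (Gu i * dp i t)) +
    \sum_e 2 * (psi e t * (Gc e * dpsi e t))).
  apply: is_deriveD; first apply: is_deriveD; first apply: is_deriveD;
    first apply: is_deriveD.
  - by apply: (is_derive_sumf
      (G := fun e t => 2 * (eta e t * (B e * deta e t)))) => i; apply/sq/eta_ode.
  - by apply: (is_derive_sumf
      (G := fun j t => 2 * (om j t * (M j * dom j t)))) => i; apply/sq/om_ode.
  - by apply: (is_derive_sumf
      (G := fun i t => 2 * (x i t * (tau i / m i * dx i t)))) => i; apply/sq/x_ode.
  - by apply: (is_derive_sumf
      (G := fun i t => 2 * (p i t * (Gu i * dp i t)))) => i; apply/sq/p_ode.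
  - by apply: (is_derive_sumf
      (G := fun e t => 2 * (psi e t * (Gc e * dpsi e t)))) => i; apply/sq/psi_ode.
apply: (is_derive_eq VD); rewrite -!mulr_sumr -!mulrDr mulNr -mulrN; congr (2 * _).
have etaE : \sum_e eta e t * (B e * deta e t) = \sum_j om j t * net j t.
  rewrite /deta /net; under eq_bigr do rewrite mulrA mulr_sumr.
  rewrite exchange_big; apply: eq_bigr => j _; rewrite mulr_sumr.
  by apply: eq_bigr => e _; ring.
have omE : \sum_j om j t * (M j * dom j t) =
    - (\sum_i om (at_bus i) t * s i t) - \sum_j D j * om j t ^+ 2 -
    \sum_j om j t * net j t.
  (* Grouping the units by bus turns the sum over units into the double sum coming from the bus
     balances. *)
  rewrite (partition_big at_bus xpredT) //= -!sumrN -!big_split /=.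
  apply: eq_bigr => j _; rewrite /dom mulVKf ?gt_eqF //.
  rewrite [X in _ = - X - _ - _](eq_bigr (fun i => om j t * s i t)) => [|i /eqP-> //].
  by rewrite -mulr_sumr; ring.
have psiE : \sum_e psi e t * (Gc e * dpsi e t) = \sum_i p i t * Hpsi i t.
  rewrite /dpsi /Hpsi; under eq_bigr do rewrite mulVKf ?gt_eqF // mulr_sumr.
  rewrite exchange_big; apply: eq_bigr => i _; rewrite mulr_sumr.
  by apply: eq_bigr => e _; ring.
have pE : \sum_i p i t * (Gu i * dp i t) =
    \sum_i p i t * s i t - \sum_i p i t * Hpsi i t.
  by rewrite -sumrB; apply: eq_bigr => i _; rewrite /dp mulVKf ?gt_eqF // mulrBr.
have xE : \sum_i x i t * (tau i / m i * dx i t) =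
    \sum_i x i t * v i t - \sum_i (m i)^-1 * x i t ^+ 2.
  rewrite -sumrB; apply: eq_bigr => i _.
  have ti : tau i != 0 by rewrite gt_eqF.
  have mi : m i != 0 by rewrite gt_eqF.
  (* The selector is moved next to [x i t], where [x_gen] absorbs it. *)
  transitivity (g i * x i t * ((m i)^-1 * (- x i t + m i * v i t))).
    by rewrite /dx; field; rewrite mi ti.
  by rewrite x_gen //; field.
have sE : \sum_i p i t * s i t - \sum_i om (at_bus i) t * s i t +
    \sum_i x i t * v i t = - \sum_i h i * v i t ^+ 2.
  rewrite -sumrB -big_split -sumrN; apply: eq_bigr => i _ /=.
  by rewrite /s /v; ring.
rewrite etaE omE psiE pE xE /W; move: sE.
lra.
Qed.

Lemma energy_ge (t : R) :
  [/\ 0 <= W t, 0 <= V t,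
      forall j, D j * om j t ^+ 2 <= W t,
      forall i, h i * v i t ^+ 2 <= W t &
      forall i, (m i)^-1 * x i t ^+ 2 <= W t] /\
  [/\ forall e, B e * eta e t ^+ 2 <= V t,
      forall j, M j * om j t ^+ 2 <= V t,
      forall i, tau i / m i * x i t ^+ 2 <= V t,
      forall i, Gu i * p i t ^+ 2 <= V t &
      forall e, Gc e * psi e t ^+ 2 <= V t].
Proof.
have ge0 (I : finType) (c : I -> R) (f : I -> R) : (forall i, 0 < c i) ->
    0 <= \sum_i c i * f i ^+ 2 /\ forall i, c i * f i ^+ 2 <= \sum_i c i * f i ^+ 2.
  move=> c0; have t0 i : 0 <= c i * f i ^+ 2 by rewrite mulr_ge0 ?sqr_ge0 ?ltW.
  split=> [|i]; first exact: sumr_ge0.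
  by rewrite (bigD1 i) //= lerDl sumr_ge0.
have mV i : 0 < (m i)^-1 by rewrite invr_gt0.
have tm i : 0 < tau i / m i by rewrite divr_gt0.
have [W1 W1'] := ge0 _ D (om ^~ t) D_gt0.
have [W2 W2'] := ge0 _ h (v ^~ t) h_gt0.
have [W3 W3'] := ge0 _ _ (x ^~ t) mV.
have [V1 V1'] := ge0 _ B (eta ^~ t) B_gt0.
have [V2 V2'] := ge0 _ M (om ^~ t) M_gt0.
have [V3 V3'] := ge0 _ _ (x ^~ t) tm.
have [V4 V4'] := ge0 _ Gu (p ^~ t) Gu_gt0.
have [V5 V5'] := ge0 _ Gc (psi ^~ t) Gc_gt0.
split; split; rewrite /W /V.
- lra.
- lra.
- by move=> i; move: (W1' i); lra.
- by move=> i; move: (W2' i); lra.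
- by move=> i; move: (W3' i); lra.
- by move=> i; move: (V1' i); lra.
- by move=> i; move: (V2' i); lra.
- by move=> i; move: (V3' i); lra.
- by move=> i; move: (V4' i); lra.
- by move=> i; move: (V5' i); lra.
Qed.

Lemma energy_decay : (forall t : R, 1 <= t -> V t <= V 1) /\
  exists l : R, (V t @[t --> +oo] --> l)%classic.
Proof.
have [||dec lim] := cvg_of_nonpos_derive is_derive_energy.
- by move=> t _; have [[W0 _ _ _ _] _] := energy_ge t; lra.
- by move=> t _; have [[]] := energy_ge t.
by split=> // t t1; exact: dec.
Qed.

Lemma bounded_of_energy {c : R} {f : R -> R} : 0 < c ->
  (forall t : R, c * f t ^+ 2 <= V t) ->
  bounded1y f.
Proof.
(* From [y ^+ 2 <= a] follows [y <= 1 + a], a bound that avoids square roots. *)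
move=> c0 fV; exists (1 + V 1 / c) => t t1.
have : f t ^+ 2 <= V 1 / c.
  rewrite ler_pdivlMr // mulrC; apply: le_trans (fV t) _.
  exact: energy_decay.1.
rewrite -real_normK ?num_real //; have := normr_ge0 (f t); nra.
Qed.

Let bounded_state : [/\ forall e, bounded1y (eta e),
  forall j, bounded1y (om j), forall i, bounded1y (x i),
  forall i, bounded1y (p i) & forall e, bounded1y (psi e)].
Proof.
by split=> i; [apply: (bounded_of_energy (B_gt0 i)) | apply: (bounded_of_energy (M_gt0 i))
  | apply: (bounded_of_energy (divr_gt0 (tau_gt0 i) (m_gt0 i)))
  | apply: (bounded_of_energy (Gu_gt0 i)) | apply: (bounded_of_energy (Gc_gt0 i))] => t;
  have [_ []] := energy_ge t.
Qed.

(** Each right-hand side is a linear combination of state components, hence inherits their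
    bounds. *)
Let C1b_state : [/\ forall e, C1b (eta e), forall j, C1b (om j), forall i, C1b (x i),
  forall i, C1b (p i) & forall e, C1b (psi e)].
Proof.
have [be bo bx bp bs] := bounded_state.
have bv i : bounded1y (v i) by apply: bounded1yD => //; exact: bounded1yN.
have bs' i : bounded1y (s i) by apply: bounded1yD; [exact: bounded1yN|apply/bounded1yN/bounded1yZ].
split=> i.
- exists (deta i); split; [exact: eta_ode | exact: be |].
  by apply: bounded1y_sum => k; exact: bounded1yZ.
- exists (dom i); split; [exact: om_ode | exact: bo | apply: bounded1yZ].
  apply: bounded1yD; first (apply: bounded1yD; last by apply/bounded1yN/bounded1yZ).
  + by apply/bounded1yN/bounded1y_sum.
  + by apply: bounded1yN; apply: bounded1y_sum => e; do 2 apply: bounded1yZ.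
- exists (dx i); split; [exact: x_ode | exact: bx | apply/bounded1yZ/bounded1yZ/bounded1yD].
    exact: bounded1yN.
  exact: bounded1yZ.
- exists (dp i); split; [exact: p_ode | exact: bp | apply/bounded1yZ/bounded1yD => //].
  by apply: bounded1yN; apply: bounded1y_sum => k; exact: bounded1yZ.
- exists (dpsi i); split; [exact: psi_ode | exact: bs | apply: bounded1yZ].
  by apply: bounded1y_sum => k; exact: bounded1yZ.
Qed.

(** [eta] and [psi] act on the other variables only through [net] and [Hpsi]. Their components in
    the kernels of these maps are not dissipated, so only [net] and [Hpsi] are claimed to vanish. *)
Lemma reduced_dynamics_cvg :
  [/\ forall j, (om j t @[t --> +oo] --> (0 : R))%classic,
      forall i, (x i t @[t --> +oo] --> (0 : R))%classic,
      forall i, (p i t @[t --> +oo] --> (0 : R))%classic,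
      forall j, (net j t @[t --> +oo] --> (0 : R))%classic &
      forall i, (Hpsi i t @[t --> +oo] --> (0 : R))%classic].
Proof.
have [Ce Co Cx Cp Cs] := C1b_state.
have Cv i : C1b (v i) by apply: C1bD => //; exact: C1bN.
have Cs' i : C1b (s i) by apply: C1bD; [exact: C1bN|apply/C1bN/C1bZ].
have Csq (c : R) f : C1b f -> C1b (fun t => c * f t ^+ 2).
  by move=> fC; apply: C1bZ; exact: C1bM.
have CW : C1b W.
  by apply: C1bD; first apply: C1bD; apply: C1b_sum => i; exact: Csq.
have W0 : (W t @[t --> +oo] --> (0 : R))%classic.
  have [_ [l Vl]] := energy_decay.
  have := cvg0Z (- 2)^-1 (barbalat_C1b Vl is_derive_energy (C1bZ (- 2) _ CW)).
  by apply: eq_cvg0 => t; field.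
have om0 j : (om j t @[t --> +oo] --> (0 : R))%classic.
  by apply: (cvg0_sq_le (D_gt0 j) W0) => t _; have [[]] := energy_ge t.
have v0 i : (v i t @[t --> +oo] --> (0 : R))%classic.
  by apply: (cvg0_sq_le (h_gt0 i) W0) => t _; have [[]] := energy_ge t.
have x0 i : (x i t @[t --> +oo] --> (0 : R))%classic.
  have mi : 0 < (m i)^-1 by rewrite invr_gt0.
  by apply: (cvg0_sq_le mi W0) => t _; have [[]] := energy_ge t.
have p0 i : (p i t @[t --> +oo] --> (0 : R))%classic.
  have := cvg0B (v0 i) (cvg0Z (- 1) (om0 (at_bus i))).
  by apply: eq_cvg0 => t; rewrite /v; ring.
have s0 i : (s i t @[t --> +oo] --> (0 : R))%classic.
  have := cvg0B (cvg0Z (-1) (x0 i)) (cvg0Z (h i) (v0 i)).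
  by apply: eq_cvg0 => t; rewrite mulN1r.
have Cnet j : C1b (net j) by apply: C1b_sum => e; do 2 apply: C1bZ.
have CHpsi i : C1b (Hpsi i) by apply: C1b_sum => e; exact: C1bZ.
split=> // [j|i].
(* Once [dom j] tends to 0, the bus equation is solved for [net j], all of whose other terms vanish
   in the limit. The next case solves the equation of [p i] for [Hpsi i] in the same way. *)
- have dom0 : (dom j t @[t --> +oo] --> (0 : R))%classic.
    apply: (barbalat_C1b (om0 j) (om_ode j)); apply: C1bZ.
    apply: C1bD; last exact: C1bN.
    by apply: C1bD; [apply/C1bN/C1b_sum | apply/C1bN/C1bZ].
  have := cvg0B (cvg0B (cvg0Z (- 1) (cvg0_sum (P := fun i => at_bus i == j) s0))
    (cvg0Z (D j) (om0 j))) (cvg0Z (M j) dom0).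
  apply: eq_cvg0 => t.
  by rewrite /dom mulVKf ?gt_eqF //; ring.
- have dp0 : (dp i t @[t --> +oo] --> (0 : R))%classic.
    apply: (barbalat_C1b (p0 i) (p_ode i)); apply: C1bZ.
    by apply: C1bD; [|exact: C1bN].
  have := cvg0B (s0 i) (cvg0Z (Gu i) dp0).
  apply: eq_cvg0 => t.
  by rewrite /dp mulVKf ?gt_eqF //; ring.
Qed.

End ReducedDynamics.

(** * Matrix form of the closed loop *)

Section ClosedLoop.
Context {R : realType} {S : system R}.
Implicit Types (z dz : state S) (i : unit_of S) (j : bus S).

(* Generator data extended to all units; a load gets the gain selector 0, and the
   junk values 1 for [unit_tau] and [unit_m]. *)
Definition unit_x z i : R :=
  match i with existT j (inl k) => xgen z k | existT j (inr _) => 0 end.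
Definition unit_tau i : R :=
  match i with existT j (inl k) => gen_tau k | existT j (inr _) => 1 end.
Definition unit_m i : R :=
  match i with existT j (inl k) => gen_m k | existT j (inr _) => 1 end.
Definition unit_is_gen i : R :=
  match i with existT j (inl _) => 1 | existT j (inr _) => 0 end.

Lemma unit_x_gen z i : unit_is_gen i * unit_x z i = unit_x z i.
Proof. by case: i => j [k|k] /=; rewrite ?mul1r ?mul0r. Qed.

Lemma prosumptionE z i :
  prosumption z i =
  - unit_x z i - unit_h i * (pc z i - omega z (tag i)) + unit_pL i.
Proof. by case: i => j [k|k] /=; rewrite /pM /dc /input ?opprD ?oppr0 ?add0r. Qed.

(** The units act on a bus only through their total prosumption, the same signal that drives the
    primal-dual scheme. This shared signal gives the product [v * s] in the energy balance. *)
Lemma bus_injection z j :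
  \sum_(k : gen j) pM z k - \sum_(k : load j) dc z k
    - \sum_(k : (gen j + load j)%type) unit_pL (uactive k) =
  - \sum_(i : unit_of S | tag i == j) prosumption z i.
Proof.
have -> : \sum_(i : unit_of S | tag i == j) prosumption z i =
    \sum_(k : (gen j + load j)%type) prosumption z (uactive k).
  (* Fixing the bus by a condition on [j'] gives an iterated sum that [sig_big_dep] merges into a
     sum over dependent pairs. *)
  transitivity (\sum_(j' | j' == j)
      \sum_(k : (gen j' + load j')%type) prosumption z (uactive k)).
    rewrite sig_big_dep /=.
    by apply: eq_big => [i|[j' k] _]; rewrite ?andbT.
  by rewrite big_pred1_eq.
have gE : \sum_(k : gen j) prosumption z (uactive (inl k)) =
    - \sum_(k : gen j) pM z k + \sum_(k : gen j) unit_pL (uactive (inl k)).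
  by rewrite -sumrN -big_split.
have lE : \sum_(k : load j) prosumption z (uactive (inr k)) =
    \sum_(k : load j) dc z k + \sum_(k : load j) unit_pL (uactive (inr k)).
  by rewrite -big_split.
by rewrite !big_sumType gE lE !opprD opprK addrACA.
Qed.

(** This is the shape of the reduced system, with one [x] equation per unit; at a load that equation
    reads 0 = 0. *)
Lemma dynamicsP (line_oriented : oriented (@line R S)) z dz :
  dynamics z dz <->
  [/\ forall e, eta dz e = \sum_j incidence R j e * omega z j,
      forall j, bus_M j * omega dz j =
        - (\sum_(i : unit_of S | tag i == j) prosumption z i)
        - bus_D j * omega z j - divergence (flow z) j,
      forall i, unit_tau i * unit_x dz i = unit_is_gen i *
        (- unit_x z i + unit_m i * (pc z i - omega z (tag i))),
      forall e, comm_Gamma e * psi dz e = \sum_i incidence R i e * pc z i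
    & forall i, unit_Gamma i * pc dz i = prosumption z i - divergence (psi z) i].
Proof.
split=> -[deta dom dx dpsi dp]; split=> //.
- by move=> e; rewrite deta incidence_transpose.
- by move=> j; rewrite dom bus_injection divergenceE // opprB addrA addrAC.
- move=> [j [k|k]] /=; last by rewrite mulr0 mul0r.
  by rewrite mul1r dx.
- by move=> e; rewrite deta incidence_transpose.
- by move=> j; rewrite dom bus_injection divergenceE // opprB addrA addrAC.
- by move=> j k; have := dx (ugen k); rewrite /= mul1r.
Qed.

Lemma equilibriumP (line_oriented : oriented (@line R S)) z :
  equilibrium z <->
  [/\ forall e : edge (@line R S), \sum_j incidence R j e * omega z j = 0,
      forall j, - (\sum_(i : unit_of S | tag i == j) prosumption z i)
        - bus_D j * omega z j - divergence (flow z) j = 0,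
      forall i, unit_is_gen i *
        (- unit_x z i + unit_m i * (pc z i - omega z (tag i))) = 0,
      forall e : edge (@comm R S), \sum_i incidence R i e * pc z i = 0
    & forall i, prosumption z i - divergence (psi z) i = 0].
Proof.
have x0 i : unit_x (state0 S) i = 0 by case: i => j [].
rewrite /equilibrium dynamicsP //; split=> -[e1 e2 e3 e4 e5]; split=> [e|j|i|e|i] /=.
- by rewrite -e1.
- by rewrite -e2 mulr0.
- by rewrite -e3 x0 mulr0.
- by rewrite -e4 mulr0.
- by rewrite -e5 mulr0.
- by rewrite e1.
- by rewrite e2 mulr0.
- by rewrite e3 x0 mulr0.
- by rewrite e4 mulr0.
- by rewrite e5 mulr0.
Qed.

(** * Equilibria, and convergence to them *)

Hypotheses (line_oriented : oriented (@line R S))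
  (line_connected : connected_graph (@line R S))
  (comm_oriented : oriented (@comm R S))
  (comm_connected : connected_graph (@comm R S))
  (B_gt0 : forall e : edge (@line R S), 0 < line_B e)
  (M_gt0 : forall j : bus S, 0 < bus_M j)
  (D_gt0 : forall j : bus S, 0 < bus_D j)
  (tau_gt0 : forall (j : bus S) (k : gen j), 0 < gen_tau k)
  (m_gt0 : forall (j : bus S) (k : gen j), 0 < gen_m k)
  (h_gt0 : forall i : unit_of S, 0 < unit_h i)
  (comm_Gamma_gt0 : forall e : edge (@comm R S), 0 < comm_Gamma e)
  (unit_Gamma_gt0 : forall i : unit_of S, 0 < unit_Gamma i).

Let sum_by_bus (f : unit_of S -> R) :
  \sum_j \sum_(i : unit_of S | tag i == j) f i = \sum_i f i.
Proof. by rewrite [RHS](partition_big (fun i => tag i) xpredT). Qed.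

(** The line equations equate the frequencies at the two ends of every line, hence everywhere by
    connectedness. Summing the bus balances, the line flows cancel, and the total prosumption is 0
    as the total of a divergence. So the common frequency times the sum of the [bus_D] is 0. *)
Lemma equilibrium_omega z : equilibrium z -> forall j, omega z j = 0.
Proof.
move=> /(equilibriumP line_oriented)[e1 e2 _ _ e5] j.
have om_edge a b : line a b -> omega z a = omega z b.
  move=> ab; pose e : edge (@line R S) := exist _ (a, b) ab.
  by have /eqP := e1 e; rewrite incidence_transpose // subr_eq0 => /eqP.
have om_cst a : omega z a = omega z j.
  have /connectP[p] := line_connected a j.
  elim: p a => [a _ -> //|b p IH a /= /andP[ab bp] jE].
  by case/orP: ab => /om_edge abE; [rewrite abE|rewrite -abE]; exact: IH.
have : \sum_a bus_D a * omega z a = 0.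
  transitivity (\sum_a (- (\sum_(i : unit_of S | tag i == a) prosumption z i) -
      divergence (flow z) a)).
    by apply: eq_bigr => a _; have := e2 a; lra.
  rewrite sumrB sumrN sum_divergence // sum_by_bus subr0.
  rewrite (eq_bigr (divergence (psi z))) => [|i _]; last by have := e5 i; lra.
  by rewrite sum_divergence // oppr0.
under eq_bigr do rewrite om_cst.
rewrite -mulr_suml => /eqP; rewrite mulf_eq0 => /orP[D0|/eqP//].
have : 0 < \sum_(a : bus S) bus_D a.
  by rewrite (bigD1 j) //= ltr_wpDr //; apply: sumr_ge0 => a _; exact: ltW.
by rewrite (eqP D0) ltxx.
Qed.

(** With zero frequencies and a common input [c], the prosumption of unit [i] is
    [unit_pL i - w i * c]. Choosing [c] so that these sum to 0 lets the right inverses of the two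
    divergences supply [psi] and the line flows. *)
Lemma equilibrium_exists : exists z : state S, equilibrium z.
Proof.
have [Gl GlE] := @divergence_right_inverse R _ _ line_oriented line_connected.
have [Gc GcE] := @divergence_right_inverse R _ _ comm_oriented comm_connected.
(* The steady-state gain of unit [i] from input to power: [m + h] for a generator, [h] for a
   load. *)
pose w i := unit_is_gen i * unit_m i + unit_h i.
have w0 i : 0 < w i.
  by rewrite /w; case: i => j [k|k] /=; rewrite ?mul0r ?mul1r ?add0r ?addr_gt0.
have [c cE] : exists c : R, (\sum_i w i) * c = \sum_(i : unit_of S) unit_pL i.
  (* Without units the total gain is 0 and cannot be divided by, but both sides are then empty
     sums. *)
  have [U0|/card_gt0P[i _]] := posnP #|unit_of S|.
    by exists 0; rewrite mulr0 big1 // => i; have := card0_eq U0 i; rewrite !inE.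
  exists ((\sum_(i : unit_of S) unit_pL i) / (\sum_i w i)); rewrite mulrC divfK //.
  by rewrite gt_eqF // (bigD1 i) //= ltr_wpDr //; apply: sumr_ge0 => k _; exact: ltW.
pose s i : R := unit_pL i - w i * c.
have s0 : \sum_i s i = 0 by rewrite sumrB -mulr_suml cE subrr.
pose net j : R := - \sum_(i : unit_of S | tag i == j) s i.
have net0 : \sum_j net j = 0 by rewrite sumrN sum_by_bus s0 oppr0.
pose z := @State R S (fun e => (\sum_k net k * Gl k e) / line_B e)
  (fun e => \sum_k s k * Gc k e) (fun=> 0) (fun j k => gen_m k * c) (fun=> c).
have xE i : unit_x z i = unit_is_gen i * (unit_m i * c).
  by case: i => j [k|k] /=; rewrite ?mul1r ?mul0r.
have sE i : prosumption z i = s i.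
  by rewrite prosumptionE xE /s /w /=; ring.
exists z; apply/equilibriumP => //; split=> [e|j|i|e|i] /=.
- by rewrite big1 // => j _; rewrite mulr0.
- rewrite (eq_bigr s) // -/(net j) mulr0 subr0 -[X in X - _](GlE _ net0).
  apply/eqP; rewrite subr_eq0; apply/eqP; apply: eq_bigr => e _.
  by congr (_ * _); rewrite /flow /= mulrC divfK ?gt_eqF.
- by rewrite xE; case: i => j [k|k] /=; ring.
- by rewrite -mulr_suml sum_incidence // mul0r.
- by rewrite sE GcE // subrr.
Qed.

Lemma solution_cvg (z : R -> state S) :
  is_solution z -> converges_to_set (@equilibrium R S) z.
Proof.
move=> [_ z_ode].
have [zs zs_eq] := equilibrium_exists.
have [e1 e2 e3 e4 e5] := (equilibriumP line_oriented zs).1 zs_eq.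
(* Subtracting the constant equilibrium leaves the derivatives unchanged, so the deviations satisfy
   the reduced system. *)
have {}z_ode (t : R) : 0 < t -> exists dz, dynamics (z t) dz /\
    forall c, is_derive t 1 (fun u => Defs.coord c (z u) - Defs.coord c zs) (Defs.coord c dz).
  move=> /z_ode[dz [dzE zdz]]; exists dz; split=> // c.
  have H := is_deriveB (dzE c) (is_derive_cst (Defs.coord c zs) t 1).
  by rewrite subr0 in H; exact: H.
pose eta' e t := eta (z t) e - eta zs e.
pose psi' e t := psi (z t) e - psi zs e.
pose om' j t := omega (z t) j - omega zs j.
pose x' i t := unit_x (z t) i - unit_x zs i.
pose p' i t := pc (z t) i - pc zs i.
have dev_prosumption i t : prosumption (z t) i - prosumption zs i =
    - x' i t - unit_h i * (p' i t - om' (tag i) t).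
  by rewrite !prosumptionE /x' /p' /om'; ring.
have dev_flow j t : divergence (flow (z t)) j - divergence (flow zs) j =
    \sum_e incidence R j e * (line_B e * eta' e t).
  rewrite -divergenceB; apply: eq_bigr => e _.
  by rewrite /flow /eta' /= [in RHS]mulrBr.
have dev_psi i t : divergence (psi (z t)) i - divergence (psi zs) i =
    \sum_e incidence R i e * psi' e t.
  exact: (esym (divergenceB _ _ _)).
have unit_tau_gt0 i : 0 < unit_tau i.
  by case: i => j [k|k] /=; [exact: tau_gt0|exact: ltr01].
have unit_m_gt0 i : 0 < unit_m i.
  by case: i => j [k|k] /=; [exact: m_gt0|exact: ltr01].
have [|||||| om0 x0 p0 net0 psi0] := @reduced_dynamics_cvg R _ _ _ _ (fun i => tag i)
  (incidence R (E := @line R S)) (incidence R (E := @comm R S)) (@line_B R S)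
  (@bus_M R S) (@bus_D R S) unit_tau unit_m (@unit_h R S) unit_is_gen
  (@unit_Gamma R S) (@comm_Gamma R S) eta' psi' om' x' p'
  B_gt0 M_gt0 D_gt0 unit_tau_gt0 unit_m_gt0 h_gt0 unit_Gamma_gt0 comm_Gamma_gt0.
- move=> e t /z_ode[dz [/(dynamicsP line_oriented)[d1 _ _ _ _] dc]].
  apply: (is_derive_eq (dc (inl (inl (inl (inl e)))))) => /=.
  rewrite d1 -[LHS]subr0 -[X in _ - X](e1 e) -sumrB.
  by apply: eq_bigr => j _; rewrite mulrBr.
- move=> j t /z_ode[dz [/(dynamicsP line_oriented)[_ d2 _ _ _] dc]].
  apply: (is_derive_eq (dc (inl (inl (inr j))))) => /=.
  apply: (canRL (mulKf _)); first by rewrite gt_eqF.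
  rewrite d2 -dev_flow -(eq_bigr _ (fun i _ => dev_prosumption i t)) sumrB.
  by have := e2 j; rewrite /om'; lra.
- move=> [j [k|k]] t /z_ode[dz [/(dynamicsP line_oriented)[_ _ d3 _ _] dc]].
    apply: (is_derive_eq (dc (inl (inr (Tagged (@gen R S) k))))).
    apply: (canRL (mulKf _)); first by rewrite gt_eqF.
    rewrite [LHS](d3 (ugen k)); have := e3 (ugen k); rewrite /x' /p' /om' /=; lra.
  (* At a load [x'] is identically 0. *)
  rewrite /= !mul0r mulr0 (_ : x' _ = cst 0); first exact: is_derive_cst.
  by apply/funext => u; rewrite /x' /= subrr.
- move=> i t /z_ode[dz [/(dynamicsP line_oriented)[_ _ _ _ d5] dc]].
  apply: (is_derive_eq (dc (inr i))) => /=.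
  apply: (canRL (mulKf _)); first by rewrite gt_eqF.
  rewrite d5 -dev_psi -dev_prosumption; have := e5 i; lra.
- move=> e t /z_ode[dz [/(dynamicsP line_oriented)[_ _ _ d4 _] dc]].
  apply: (is_derive_eq (dc (inl (inl (inl (inr e)))))) => /=.
  apply: (canRL (mulKf _)); first by rewrite gt_eqF.
  rewrite d4 -[LHS]subr0 -[X in _ - X](e4 e) -sumrB.
  by apply: eq_bigr => i _; rewrite mulrBr.
- by move=> i t _; rewrite /x' mulrBr !unit_x_gen.
have [Gl GlE] := @divergence_right_inverse R _ _ line_oriented line_connected.
have [Gc GcE] := @divergence_right_inverse R _ _ comm_oriented comm_connected.
pose net t j : R := \sum_e incidence R j e * (line_B e * eta' e t).
pose exc t i : R := \sum_e incidence R i e * psi' e t.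
(* The nearby equilibrium varies with [t]: it keeps [eta] and [psi] of [z t] up to a correction
   cancelling the excess divergence, and takes its other components from [zs]. Dividing by [line_B]
   converts a flow correction into one of [eta]. *)
pose a t := @State R S
  (fun e => eta (z t) e - (line_B e)^-1 * (\sum_k net t k * Gl k e))
  (fun e => psi (z t) e - \sum_k exc t k * Gc k e)
  (omega zs) (fun j k => xgen zs k) (pc zs).
have a_eq t : equilibrium (a t).
  (* The excesses are themselves divergences, so they have total 0, as the right inverses
     require. *)
  have net_sum : \sum_j net t j = 0 by exact: sum_divergence.
  have exc_sum : \sum_i exc t i = 0 by exact: sum_divergence.
  have xa i : unit_x (a t) i = unit_x zs i by case: i => j [].
  have sa i : prosumption (a t) i = prosumption zs i by rewrite !prosumptionE xa.
  apply/equilibriumP => //; split=> [//|j|i|//|i].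
  - rewrite (eq_bigr _ (fun i _ => sa i)) -[RHS](e2 j); congr (_ - _).
    transitivity (divergence (fun e => flow (z t) e - \sum_k net t k * Gl k e) j).
      by apply: eq_bigr => e _; rewrite /flow /= mulrBr mulVKf // gt_eqF.
    by rewrite divergenceB GlE // /net -dev_flow; ring.
  - by rewrite xa e3.
  - rewrite sa -[RHS](e5 i); congr (_ - _).
    by rewrite [LHS]divergenceB GcE // /exc -dev_psi; ring.
(* The corrections are combinations, with coefficients independent of [t], of the vanishing excesses
   [net] and [exc]. *)
have za0 c : ((Defs.coord c (z t) - Defs.coord c (a t)) @[t --> +oo] --> (0 : R))%classic.
  case: c => [[[[e|e]|j]|[j k]]|i].
  - apply: (eq_cvg0 _ (cvg0Z (line_B e)^-1
      (cvg0_sum (P := xpredT) (fun k => cvg0Z (Gl k e) (net0 k))))) => t /=.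
    rewrite subKr; congr (_ * _); apply: eq_bigr => k _; exact: mulrC.
  - apply: (eq_cvg0 _
      (cvg0_sum (P := xpredT) (fun k => cvg0Z (Gc k e) (psi0 k)))) => t /=.
    rewrite subKr; apply: eq_bigr => k _; exact: mulrC.
  - exact: om0.
  - exact: (x0 (ugen k)).
  - exact: p0.
move=> eps eps0.
have : \forall t \near (+oo)%R, forall c, `|Defs.coord c (z t) - Defs.coord c (a t)| < eps.
  (* There are finitely many coordinates, so one threshold in time serves all of them. *)
  by apply: filter_forall => c; exact: (cvgr0Pnorm_lt _).1.
by apply: filterS => t H; exists (a t).
Qed.

End ClosedLoop.

Theorem theorem1 (R : realType) (S : system R)
  (line_oriented : oriented (@line R S))
  (line_connected : connected_graph (@line R S))
  (comm_oriented : oriented (@comm R S))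
  (comm_connected : connected_graph (@comm R S))
  (B_gt0 : forall e : edge (@line R S), 0 < line_B e)
  (M_gt0 : forall j : bus S, 0 < bus_M j)
  (D_gt0 : forall j : bus S, 0 < bus_D j)
  (tau_gt0 : forall (j : bus S) (k : gen j), 0 < gen_tau k)
  (m_gt0 : forall (j : bus S) (k : gen j), 0 < gen_m k)
  (h_gt0 : forall i : unit_of S, 0 < unit_h i)
  (comm_Gamma_gt0 : forall e : edge (@comm R S), 0 < comm_Gamma e)
  (unit_Gamma_gt0 : forall i : unit_of S, 0 < unit_Gamma i) :
  (forall (z0 : state S) (z : R -> state S),
     is_solution z -> z 0 = z0 -> converges_to_set (@equilibrium R S) z) /\
  (forall z : state S, equilibrium z -> forall j : bus S, omega z j = 0).
Proof.
split=> [z0 z z_sol _|]; first exact: solution_cvg.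
exact: equilibrium_omega.
Qed.
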